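(* Let $A$ be a square complex matrix, and let $r_1, r_2,\dots,r_t, A_t$ be the output obtained by applying the consimilarity reduction algorithm (described in the context) to $A$, with any admissible choice of the unitary matrices in its steps. Then $$r_1\ge r_2\ge\dots\ge r_t,$$ and $A$ is consimilar to $$J_1^{(r_1-r_2)}\oplus J_2^{(r_2-r_3)}\oplus\cdots\oplus J_{t-1}^{(r_{t-1}-r_t)}\oplus J_t^{(r_t)}\oplus A_t,$$ where $J_k:=J_k(0)$. Moreover, $A_t$ is determined by $A$ up to consimilarity and the other summands are uniquely determined by $A$; that is, if $A$ is consimilar to $J_1^{(m_1)}\oplus\cdots\oplus J_s^{(m_s)}\oplus C$ with $C$ nonsingular and integers $m_i\ge 0$, then (setting $r_i:=0$ for $i>t$ and $m_i:=0$ for $i>s$) $m_i=r_i-r_{i+1}$ for all $i\ge 1$, and $C$ is consimilar to $A_t$.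
   Context: All matrices are complex; $\bar S$ denotes the entrywise complex conjugate of $S$. Square matrices $A,B$ of the same size are consimilar if $SA\bar S^{-1}=B$ for some nonsingular $S$. Matrices of size $m\times 0$, $0\times n$ and $0\times 0$ are allowed; the $0\times 0$ matrix is nonsingular. $J_k(0)$ is the $k\times k$ nilpotent Jordan block, with ones on the first subdiagonal and zeros elsewhere (using the superdiagonal instead gives a consimilar matrix). For a matrix $M$ and an integer $n\ge 0$, $M^{(n)}$ is the direct sum of $n$ copies of $M$ (the $0\times 0$ matrix if $n=0$). Consimilarity reduction algorithm. Input: an $n\times n$ matrix $A=:A_0$. For $i=1,2,\dots$, as long as $A_{i-1}$ is singular, perform step $i$: choose a unitary matrix $S_i$ such that $$S_iA_{i-1}=\begin{bmatrix}0\\ A'\end{bmatrix},$$ where the zero block has $r_i$ rows and the rows of $A'$ are linearly independent (so $r_i$ is the size of $A_{i-1}$ minus its rank). Then $$S_iA_{i-1}\bar S_i^{-1}=\begin{bmatrix}0_{r_i}&0\\ \star & A_i\end{bmatrix},$$ where $0_{r_i}$ is the $r_i\times r_i$ zero matrix; this defines the square matrix $A_i$ (and the rows of $[\star\ A_i]$ are linearly independent). The algorithm stops at the first $t$ for which $A_t$ is nonsingular; the output is the sequence $r_1,r_2,\dots,r_t,A_t$. If $A$ is already nonsingular, then $t=0$, $A_t=A$, and there are no numbers $r_i$. *)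

(* Defs.v *)
From HB Require Import structures.
From mathcomp Require Import all_boot all_order all_algebra.
From mathcomp Require Import reals complex.

Set Implicit Arguments.
Unset Strict Implicit.
Unset Printing Implicit Defensive.

Import Order.TTheory GRing.Theory Num.Theory.

Local Open Scope ring_scope.

Definition conj_mx (C : numClosedFieldType) (m n : nat) (S : 'M[C]_(m, n)) :
  'M[C]_(m, n) := map_mx Num.conj S.

(* The sizes may differ syntactically; e identifies them, so that block sums
   such as 'M_(p + q) can be compared with 'M_n. *)
Definition consimilar (C : numClosedFieldType) (m n : nat)
    (A : 'M[C]_m) (B : 'M[C]_n) : Prop :=
  exists (e : m = n) (S : 'M[C]_n),
    S \in unitmx /\ S *m castmx (e, e) A *m invmx (conj_mx S) = B.

Definition jordan0 (C : numClosedFieldType) (k : nat) : 'M[C]_k :=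
  \matrix_(i, j) (i == j.+1 :> nat)%:R.

Definition mxcopies (C : numClosedFieldType) (k : nat) (M : 'M[C]_k) (n : nat) :
    'M[C]_(\sum_(i < n) k) :=
  \mxdiag_(i < n) M.

(* J_1^(m_1) (+) ... (+) J_s^(m_s) for m = [:: m_1; ...; m_s]: the entry of
   index i (from 0) is the multiplicity of the block of size i.+1. *)
Definition jordan0_sum (C : numClosedFieldType) (m : seq nat) :
    'M[C]_(\sum_(i < size m) \sum_(j < nth 0%N m i) i.+1) :=
  \mxdiag_(i < size m) mxcopies (jordan0 C i.+1) (nth 0%N m i).

Definition dsum_mx (C : numClosedFieldType) (p q : nat)
    (M : 'M[C]_p) (N : 'M[C]_q) : 'M[C]_(p + q) :=
  block_mx M 0 0 N.

(* reduction_output A r B: some run of the consimilarity reduction algorithm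
   on A, with some choice of the unitary matrices, outputs the numbers
   r = [:: r_1; ...; r_t] and the final matrix B.  A step applies to a matrix
   whose size is split as r1 + p; row_free A' forces r1 to be the corank. *)
Inductive reduction_output (C : numClosedFieldType) :
    forall n : nat, 'M[C]_n -> seq nat -> forall q : nat, 'M[C]_q -> Prop :=
| reduction_stop (n : nat) (A : 'M[C]_n) of A \in unitmx :
    reduction_output A [::] A
| reduction_step (r1 p : nat) (A S : 'M[C]_(r1 + p)) (A' : 'M[C]_(p, r1 + p))
    (r : seq nat) (q : nat) (B : 'M[C]_q) of
    A \notin unitmx &
    S \is unitarymx &
    S *m A = col_mx 0 A' &
    row_free A' &
    reduction_output (drsubmx (S *m A *m invmx (conj_mx S))) r B :
    reduction_output A (r1 :: r) B.

(* Main.v *)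
(** The matrix [A] encodes the semilinear map [v |-> conj (v A)] on row vectors,
and a consimilarity of [A] with [J_1^(m_1) (+) ... (+) J_s^(m_s) (+) N] is a
basis of row vectors made of Jordan chains [t, Phi t, ..., Phi^(k-1) t] with
[Phi^k t = 0] and of rows [U] with [U A = N conj U].  A step of the algorithm
replaces [Phi] by the map it induces on the quotient by its kernel, of dimension
[r_1].  Passing to the quotient drops the last vector of each chain, so the
chains of length 1 disappear and [r_1] is the number of chains.  Conversely, the
tops of a chain basis of the quotient lift to chains that are one vector longer
and whose last vectors are independent in the kernel; completing these to a basis
of the kernel adds [r_1 - r_2] chains of length 1.  Both halves of the theorem
follow by induction on the run of the algorithm. *)

Require Import Defs.
From HB Require Import structures.
From mathcomp Require Import all_boot all_order all_algebra.
From mathcomp Require Import reals complex.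
From mathcomp Require Import zify.

Set Implicit Arguments.
Unset Strict Implicit.
Unset Printing Implicit Defensive.

Import Order.TTheory GRing.Theory Num.Theory.

Local Open Scope ring_scope.

Section Consimilarity.

Variable C : numClosedFieldType.

(** * Entrywise conjugation, and consimilarity as an intertwining relation *)

Lemma conj_mxK m n : involutive (@conj_mx C m n).
Proof. by move=> A; apply/matrixP=> i j; rewrite !mxE conjCK. Qed.

Lemma conj_mxM m n p (A : 'M[C]_(m, n)) (B : 'M[C]_(n, p)) :
  conj_mx (A *m B) = conj_mx A *m conj_mx B.
Proof. exact: map_mxM. Qed.

Lemma conj_mx0 m n : conj_mx 0 = 0 :> 'M[C]_(m, n).
Proof. exact: map_mx0. Qed.

Lemma row_free_conj m n (A : 'M[C]_(m, n)) : row_free (conj_mx A) = row_free A.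
Proof. exact: row_free_map. Qed.

Lemma unitmx_conj n (A : 'M[C]_n) : (conj_mx A \in unitmx) = (A \in unitmx).
Proof. by rewrite -!row_free_unit row_free_conj. Qed.

(** Moving the inverse to the other side and letting [S] be rectangular eliminates both [invmx] and
    [castmx]. Since [m = n], [row_free S] means that the rows of [S] form a basis. *)
Lemma consimilarP m n (A : 'M[C]_m) (B : 'M[C]_n) :
  consimilar A B <->
  m = n /\ exists2 S : 'M[C]_(n, m), row_free S & S *m A = B *m conj_mx S.
Proof.
split=> [[e [S [uS <-]]] | [e [S fS eS]]].
  case: n / e B S uS => _ S uS; split=> //; exists S; first by rewrite row_free_unit.
  by rewrite castmx_id -mulmxA mulVmx ?mulmx1 // unitmx_conj.
case: n / e B S fS eS => B S; rewrite row_free_unit => uS eS.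
exists erefl, S; split; rewrite // castmx_id eS mulmxK //.
by rewrite unitmx_conj.
Qed.

Lemma consimilar_sym m n (A : 'M[C]_m) (B : 'M[C]_n) :
  consimilar A B -> consimilar B A.
Proof.
move=> /consimilarP[e [S]]; case: n / e B S => B S; rewrite row_free_unit => uS eS.
apply/consimilarP; split=> //; exists (invmx S).
  by rewrite row_free_unit unitmx_inv.
apply: (can_inj (mulKmx uS)); rewrite mulmxA mulmxV // mul1mx mulmxA eS -mulmxA.
by rewrite -conj_mxM mulmxV // /conj_mx map_mx1 mulmx1.
Qed.

(** * The semilinear map of a matrix and its Jordan chains *)

Definition semi n (A : 'M[C]_n) (v : 'rV[C]_n) : 'rV[C]_n := conj_mx (v *m A).

Lemma semiD n (A : 'M[C]_n) : {morph semi A : u v / u + v}.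
Proof. by move=> u v; rewrite /semi mulmxDl /conj_mx map_mxD. Qed.

Lemma semi0 n (A : 'M[C]_n) : semi A 0 = 0.
Proof. by rewrite /semi mul0mx conj_mx0. Qed.

Lemma semiZ n (A : 'M[C]_n) a v : semi A (a *: v) = a^* *: semi A v.
Proof. by rewrite /semi -scalemxAl /conj_mx map_mxZ. Qed.

Lemma semi_sum n (A : 'M[C]_n) I (s : seq I) P (F : I -> 'rV[C]_n) :
  semi A (\sum_(i <- s | P i) F i) = \sum_(i <- s | P i) semi A (F i).
Proof. exact: (big_morph _ (semiD A) (semi0 A)). Qed.

Lemma iter_semi0 n (A : 'M[C]_n) k : iter k (semi A) 0 = 0.
Proof. by elim: k => //= k ->; rewrite semi0. Qed.

Lemma semi_unit_inj n (A : 'M[C]_n) v : A \in unitmx -> semi A v = 0 -> v = 0.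
Proof.
move=> uA /(congr1 (@conj_mx _ _ _)); rewrite conj_mxK conj_mx0 => /eqP.
by rewrite mulmx_free_eq0 ?row_free_unit // => /eqP.
Qed.

(* [top i j] is the top vector of the [j]-th chain of length [i.+1]; its values for
   [j >= nth 0 m i] are junk. *)
Definition chain_sum n (A : 'M[C]_n) (m : seq nat)
    (top : nat -> nat -> 'rV[C]_n) (x : nat -> nat -> nat -> C) : 'rV[C]_n :=
  \sum_(i < size m) \sum_(j < nth 0%N m i) \sum_(a < i.+1)
    x i j a *: iter a (semi A) (top i j).

Definition chain_indep n (A : 'M[C]_n) m c (U : 'M[C]_(c, n)) top :=
  forall x y, chain_sum A m top x + y *m U = 0 ->
    (forall i j a, (j < nth 0 m i)%N -> (a <= i)%N -> x i j a = 0) /\ y = 0.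

Definition chain_dim (m : seq nat) : nat :=
  (\sum_(i < size m) \sum_(j < nth 0 m i) i.+1)%N.

(* The last vector of a chain comes first, because [jordan0] has its ones on the
   subdiagonal. *)
Definition chain_mx n (A : 'M[C]_n) m (top : nat -> nat -> 'rV[C]_n) :
    'M[C]_(chain_dim m, n) :=
  \mxcol_(i < size m) \mxcol_(j < nth 0%N m i)
    \matrix_(a < i.+1) iter (i - a) (semi A) (top i j).

Lemma nth_pos_size (m : seq nat) i j : (j < nth 0 m i)%N -> (i < size m)%N.
Proof. by case: (ltnP i (size m)) => // ?; rewrite nth_default. Qed.

Lemma chain_sumE n (A : 'M[C]_n) m top x :
  chain_sum A m top x =
  (\mxrow_(i < size m) \mxrow_(j < nth 0%N m i) \row_(a < i.+1) x i j (i - a)%N)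
    *m chain_mx A m top.
Proof.
rewrite mul_mxrow_mxcol; apply: eq_bigr => i _.
rewrite mul_mxrow_mxcol; apply: eq_bigr => j _.
rewrite mulmx_sum_row (reindex_inj rev_ord_inj); apply: eq_bigr => a _.
by rewrite /= subSS mxE rowK.
Qed.

(** Tops and coefficients are indexed by plain [nat], which avoids index types depending on [m];
    this converts data read off a block matrix to that form. *)
Definition extend (T : Type) (z : T) k (f : 'I_k -> T) (i : nat) : T :=
  oapp f z (insub i).

Lemma extendE T (z : T) k (f : 'I_k -> T) (i : 'I_k) : extend z f i = f i.
Proof. by rewrite /extend valK. Qed.

Lemma chain_indepP n (A : 'M[C]_n) m c (U : 'M[C]_(c, n)) top :
  row_free (col_mx (chain_mx A m top) U) <-> chain_indep A m U top.
Proof.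
split=> [fr x y | ind].
  rewrite chain_sumE -mul_row_col => /eqP; rewrite mulmx_free_eq0 // => /eqP.
  rewrite -[0 in RHS]row_mx0 => /eq_row_mx[/eqP eqx ->]; split=> // i j a ltj lea.
  have lti := nth_pos_size ltj.
  move/eqP: eqx; rewrite -[0 in RHS]mxrow0 => /eq_mxrowP/(_ (Ordinal lti))/=.
  rewrite -[0 in RHS]mxrow0 => /eq_mxrowP/(_ (Ordinal ltj))/=.
  by move=> /rowP/(_ (rev_ord (Ordinal (lea : (a < i.+1)%N)))); rewrite !mxE /= subSS subKn.
apply: inj_row_free => v; rewrite -[v]hsubmxK mul_row_col.
set w := lsubmx v; set y := rsubmx v.
pose x i j a := extend 0 (fun i' : 'I_(size m) => extend 0 (fun j' : 'I_(nth 0%N m i') =>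
  submxrow (submxrow w i') j' 0 (inord (i' - a))) j) i.
have -> : w = (\mxrow_(i < size m) \mxrow_(j < nth 0%N m i) \row_(a < i.+1) x i j (i - a)%N).
  rewrite -[w]submxrowK; apply: eq_mxrow => i; rewrite -[LHS]submxrowK; apply: eq_mxrow => j.
  apply/rowP=> a; rewrite [RHS]mxE /x !extendE subKn ?inord_val //.
  by rewrite -ltnS.
rewrite -chain_sumE => /ind[x0 ->]; rewrite -[RHS]row_mx0; congr row_mx.
rewrite -[RHS]mxrow0; apply: eq_mxrow => i; rewrite -[RHS]mxrow0; apply: eq_mxrow => j.
by apply/rowP=> a; rewrite !mxE x0 // leq_subr.
Qed.

(** Inside a block, every row but the first satisfies the matrix equation by construction, being an
    iterate of the same top. The first row is the end of the chain and faces the zero row of the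
    Jordan block, so it alone carries a condition. *)
Lemma chain_mx_jordan n (A : 'M[C]_n) m top :
  (forall i j, (j < nth 0 m i)%N -> iter i.+1 (semi A) (top i j) = 0) <->
  chain_mx A m top *m A = jordan0_sum C m *m conj_mx (chain_mx A m top).
Proof.
have chain_mxA : chain_mx A m top *m A = \mxcol_(i < size m) \mxcol_(j < nth 0%N m i)
    \matrix_(a < i.+1) conj_mx (iter (i - a).+1 (semi A) (top i j)).
  rewrite mxcol_mul; apply: eq_mxcol => i; rewrite mxcol_mul; apply: eq_mxcol => j.
  by apply/row_matrixP => a; rewrite row_mul !rowK iterS conj_mxK.
have jordan_chain : jordan0_sum C m *m conj_mx (chain_mx A m top) =
    \mxcol_(i < size m) \mxcol_(j < nth 0%N m i)
    \matrix_(a < i.+1) (if a == 0 :> nat then 0 else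
       conj_mx (iter (i - a).+1 (semi A) (top i j))).
  rewrite [conj_mx _](_ : _ = \mxcol_(i < size m) \mxcol_(j < nth 0%N m i)
    \matrix_(a < i.+1) conj_mx (iter (i - a) (semi A) (top i j))); last first.
    by apply/matrixP=> a b; rewrite !mxE.
  rewrite mul_mxdiag_mxcol; apply: eq_mxcol => i.
  rewrite mul_mxdiag_mxcol; apply: eq_mxcol => j.
  apply/row_matrixP => a; rewrite row_mul rowK mulmx_sum_row.
  under eq_bigr do rewrite rowK !mxE.
  case: a => [[|a] lta] /=; first by rewrite big1 // => b _; rewrite scale0r.
  rewrite (bigD1 (Ordinal (ltnW lta))) //= eqxx scale1r big1 ?addr0.
    by rewrite -iterS subnSK.
  move=> b neb; rewrite eqSS; case: eqP => [e|_]; last by rewrite scale0r.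
  by case/eqP: neb; apply: val_inj.
rewrite chain_mxA jordan_chain; split=> [kill | eqM i j ltj].
  apply: eq_mxcol => i; apply: eq_mxcol => j; apply/row_matrixP => a; rewrite !rowK.
  by case: eqP => // ->; rewrite subn0 kill // conj_mx0.
move/eq_mxcolP: eqM => /(_ (Ordinal (nth_pos_size ltj))).
move=> /eq_mxcolP/(_ (Ordinal ltj)) /row_matrixP/(_ ord0); rewrite !rowK /= subn0.
by move/(congr1 (@conj_mx _ _ _)); rewrite conj_mxK conj_mx0.
Qed.

(** Spanning is expressed by the dimension count: independent vectors, [n] of them in total, form a
    basis. *)
Record chain_basis n (A : 'M[C]_n) m c (N : 'M[C]_c) (U : 'M[C]_(c, n)) top : Prop :=
  ChainBasis {
    chain_basis_dim : (chain_dim m + c)%N = n;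
    chain_basis_kill :
      forall i j, (j < nth 0 m i)%N -> iter i.+1 (semi A) (top i j) = 0;
    chain_basis_stable : U *m A = N *m conj_mx U;
    chain_basis_indep : chain_indep A m U top }.

Lemma chain_basis_consimilar n (A : 'M[C]_n) m c (N : 'M[C]_c) :
  consimilar A (dsum_mx (jordan0_sum C m) N) <->
  exists U top, @chain_basis n A m c N U top.
Proof.
have dsumE (S1 : 'M[C]_(chain_dim m, n)) (U : 'M[C]_(c, n)) :
    (col_mx S1 U *m A = dsum_mx (jordan0_sum C m) N *m conj_mx (col_mx S1 U)) <->
    S1 *m A = jordan0_sum C m *m conj_mx S1 /\ U *m A = N *m conj_mx U.
  rewrite /dsum_mx /conj_mx map_col_mx mul_block_col mul_col_mx !mul0mx addr0 add0r.
  by split=> [/eq_col_mx | [-> ->]].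
rewrite consimilarP; split=> [[e [S]] | [U [top [e kill stab ind]]]].
  rewrite -[S]vsubmxK; set S1 := usubmx S; set U := dsubmx S.
  move=> fS /dsumE[eS1 eU].
  (* Blocks list their chains from the end, so the top of a chain is the last row of its block. *)
  pose top i j := extend 0 (fun i' : 'I_(size m) => extend 0 (fun j' : 'I_(nth 0%N m i') =>
    row ord_max (submxcol (submxcol S1 i') j')) j) i.
  suff eS : S1 = chain_mx A m top.
    exists U, top; split=> //.
    - by apply/chain_mx_jordan; rewrite -eS.
    - by apply/chain_indepP; rewrite -eS.
  rewrite -[LHS]submxcolK; apply: eq_mxcol => i; rewrite -[LHS]submxcolK; apply: eq_mxcol => j.
  set M := submxcol _ _.
  have eM : M *m A = jordan0 C i.+1 *m conj_mx M.
    move: eS1; rewrite -[S1]submxcolK mxcol_mul.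
    rewrite [conj_mx _](_ : _ = \mxcol_i conj_mx (submxcol S1 i)); last first.
      by apply/matrixP=> a b; rewrite !mxE.
    rewrite mul_mxdiag_mxcol => /eq_mxcolP/(_ i).
    rewrite -[submxcol S1 i]submxcolK mxcol_mul.
    rewrite [conj_mx _](_ : _ = \mxcol_j conj_mx (submxcol (submxcol S1 i) j)); last first.
      by apply/matrixP=> a b; rewrite !mxE.
    by rewrite mul_mxdiag_mxcol => /eq_mxcolP/(_ j).
  have stepM (a b : 'I_i.+1) : a = b.+1 :> nat -> semi A (row a M) = row b M.
    move=> eab; rewrite /semi -row_mul eM row_mul mulmx_sum_row (bigD1 b) //=.
    rewrite !mxE eab eqxx scale1r big1 ?addr0; first by rewrite /conj_mx -map_row; exact: conj_mxK.
    move=> d nedb; rewrite !mxE eab eqSS; case: eqP => [e1|_]; last by rewrite scale0r.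
    by case/eqP: nedb; apply: val_inj.
  have iterM k : (k <= i)%N -> iter k (semi A) (row ord_max M) = row (inord (i - k)) M.
    elim: k => [|k IH] lek /=; first by rewrite subn0; congr row; apply: val_inj; rewrite /= inordK.
    rewrite IH; last exact: ltnW.
    by apply: stepM; rewrite !inordK ?ltnS ?leq_subr // subnSK.
  apply/row_matrixP=> a; rewrite rowK /top !extendE -/M iterM ?leq_subr //.
  by rewrite subKn ?inord_val // -ltnS.
split; first by [].
exists (col_mx (chain_mx A m top) U); first exact/chain_indepP.
by apply/dsumE; split=> //; apply/chain_mx_jordan.
Qed.


Lemma consimilar_trans m n p (A : 'M[C]_m) (B : 'M[C]_n) (D : 'M[C]_p) :
  consimilar A B -> consimilar B D -> consimilar A D.
Proof.
move=> /consimilarP[e1 [S fS eS]] /consimilarP[e2 [T fT eT]].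
apply/consimilarP; split; first exact: etrans e1 e2.
exists (T *m S); last by rewrite -mulmxA eS mulmxA eT -mulmxA conj_mxM.
by rewrite -row_leq_rank mxrankMfree // row_leq_rank.
Qed.

(** * Shortening chains by one vector, and independence of their ends *)

Lemma chain_dim_behead m : chain_dim m = (sumn m + chain_dim (behead m))%N.
Proof.
have dimE s : chain_dim s = (\sum_(i < size s) nth 0 s i * i.+1)%N.
  by apply: eq_bigr => i _; rewrite sum_nat_const card_ord.
case: m => [|d m]; first by rewrite /chain_dim !big_ord0.
rewrite !dimE big_ord_recl /= muln1 -addnA sumnE (big_nth 0%N) big_mkord -big_split.
by congr addn; apply: eq_bigr => i _; rewrite mulnS.
Qed.

(** Separates the chains of length 1, the longer chains without their ends, and those ends: the
    three groups that behave differently modulo the kernel. *)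
Lemma chain_sum_cons n (A : 'M[C]_n) d m top x :
  chain_sum A (d :: m) top x = \sum_(j < d) x 0 j 0 *: top 0 j +
    (chain_sum A m (fun i => top i.+1) (fun i => x i.+1) +
     \sum_(i < size m) \sum_(j < nth 0%N m i)
       x i.+1 j i.+1 *: iter i.+1 (semi A) (top i.+1 j)).
Proof.
rewrite /chain_sum big_ord_recl; congr (_ + _).
  by apply: eq_bigr => j _; rewrite big_ord_recl big_ord0 addr0.
rewrite -big_split; apply: eq_bigr => i _; rewrite -big_split; apply: eq_bigr => j _.
exact: big_ord_recr.
Qed.

Definition vec_indep p (m : seq nat) (g : nat -> nat -> 'rV[C]_p) :=
  forall y : nat -> nat -> C,
    \sum_(i < size m) \sum_(j < nth 0%N m i) y i j *: g i j = 0 ->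
    forall i j, (j < nth 0 m i)%N -> y i j = 0.

Lemma chain_socle_indep n (A : 'M[C]_n) m c (U : 'M[C]_(c, n)) top :
  chain_indep A m U top ->
  vec_indep m (fun i j => iter i (semi A) (top i j)).
Proof.
move=> ind y eq0 i j ltj.
pose x i j a := if a == i :> nat then y i j else 0.
case: (ind x 0) => [|x0 _]; last by have := x0 i j i ltj (leqnn i); rewrite /x eqxx.
rewrite mul0mx addr0 -[RHS]eq0; apply: eq_bigr => i' _; apply: eq_bigr => j' _.
rewrite big_ord_recr /= /x eqxx big1 ?add0r // => a _.
by rewrite ltn_eqF ?scale0r.
Qed.

(** The vectors [h j] form a basis of a complement of the span of the [g i j]. *)
Lemma vec_indep_complement p m (g : nat -> nat -> 'rV[C]_p) :
  vec_indep m g ->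
  (sumn m <= p)%N /\ exists h : nat -> 'rV[C]_p, forall (z : nat -> C) (y : nat -> nat -> C),
    \sum_(j < p - sumn m) z j *: h j +
      \sum_(i < size m) \sum_(j < nth 0%N m i) y i j *: g i j = 0 ->
    (forall j, (j < p - sumn m)%N -> z j = 0) /\
    (forall i j, (j < nth 0 m i)%N -> y i j = 0).
Proof.
move=> ind; pose G := \mxcol_(i < size m) \matrix_(j < nth 0%N m i) g i j.
have sumG (y : nat -> nat -> C) : \sum_(i < size m) \sum_(j < nth 0%N m i) y i j *: g i j =
    (\mxrow_(i < size m) \row_(j < nth 0%N m i) y i j) *m G.
  rewrite mul_mxrow_mxcol; apply: eq_bigr => i _; rewrite mulmx_sum_row.
  by apply: eq_bigr => j _; rewrite mxE rowK.
have fG : row_free G.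
  apply: inj_row_free => v.
  pose y i j := extend 0 (fun i' : 'I_(size m) => extend 0 (submxrow v i' 0) j) i.
  have -> : v = \mxrow_(i < size m) \row_(j < nth 0%N m i) y i j.
    rewrite -[LHS]submxrowK; apply: eq_mxrow => i; apply/rowP=> j.
    by rewrite [RHS]mxE /y !extendE.
  rewrite -sumG => /ind y0; rewrite -[RHS]mxrow0; apply: eq_mxrow => i.
  by apply/rowP=> j; rewrite !mxE y0.
have sumnm : sumn m = (\sum_(i < size m) nth 0 m i)%N.
  by rewrite sumnE (big_nth 0%N) big_mkord.
have rG : \rank G = sumn m by rewrite sumnm; apply/eqP.
have rGC : \rank G^C%MS = (p - sumn m)%N by rewrite mxrank_compl rG.
split; first by rewrite -rG rank_leq_col.
exists (extend 0 (fun j => row j (row_base G^C%MS))) => z y.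
set H := row_base _.
have -> : \sum_(j < p - sumn m) z j *: extend 0 (fun j => row j H) j =
    (\row_j z j) *m H.
  rewrite -rGC mulmx_sum_row; apply: eq_bigr => j _.
  by rewrite extendE mxE.
rewrite sumG => eq0.
(* The [H] part is the opposite of the [G] part, so it lies both in the span of [G] and in its
   complement. *)
have zH0 : (\row_j z j) *m H = 0.
  apply/eqP; rewrite -submx0 -(capmx_compl G) sub_capmx; apply/andP; split.
    by rewrite -[X in (X <= _)%MS]opprK eqmx_opp (addr0_eq eq0) submxMl.
  by apply: submx_trans (submxMl _ _) _; rewrite eq_row_base.
split=> [j ltj | ].
  rewrite -rGC in ltj; move/eqP: zH0.
  rewrite mulmx_free_eq0 ?row_base_free // => /eqP/rowP/(_ (Ordinal ltj)).
  by rewrite !mxE.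
by apply: ind; rewrite sumG -[RHS]eq0 zH0 add0r.
Qed.

(** * One step of the algorithm: passing to the quotient by the kernel, and back *)

Section Step.

Variables (r p : nat) (B : 'M[C]_(r + p)).
Hypotheses (B0 : usubmx B = 0) (fB : row_free (dsubmx B)).

Lemma mulmx_usub0 k (V : 'M[C]_(k, r + p)) : V *m B = rsubmx V *m dsubmx B.
Proof. by rewrite -{1}[V]hsubmxK -{1}[B]vsubmxK mul_row_col B0 mulmx0 add0r. Qed.

Lemma rsubmx_mul k (V : 'M[C]_(k, r + p)) : rsubmx (V *m B) = rsubmx V *m drsubmx B.
Proof. by rewrite mulmx_usub0 -mulmx_rsub. Qed.

Lemma rsubmx_conj k (V : 'M[C]_(k, r + p)) : rsubmx (conj_mx V) = conj_mx (rsubmx V).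
Proof. by rewrite /conj_mx map_rsubmx. Qed.

Lemma rsubmx_semi v : rsubmx (semi B v) = semi (drsubmx B) (rsubmx v).
Proof. by rewrite /semi rsubmx_conj rsubmx_mul. Qed.

Lemma rsubmx_iter_semi k v :
  rsubmx (iter k (semi B) v) = iter k (semi (drsubmx B)) (rsubmx v).
Proof. by elim: k => //= k IH; rewrite rsubmx_semi IH. Qed.

(** The kernel consists of the rows supported on the first [r] coordinates. Hence [rsubmx] is the
    quotient map, and [drsubmx B] represents the induced map. *)
Lemma semi_eq0 v : semi B v = 0 <-> rsubmx v = 0.
Proof.
split=> [/(congr1 (@conj_mx _ _ _))|v0].
  rewrite conj_mxK conj_mx0 mulmx_usub0 => /eqP.
  by rewrite mulmx_free_eq0 // => /eqP.
by rewrite /semi mulmx_usub0 v0 mul0mx conj_mx0.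
Qed.

Lemma rsubmx_chain_sum m top x :
  rsubmx (chain_sum B m top x) =
  chain_sum (drsubmx B) m (fun i j => rsubmx (top i j)) x.
Proof.
rewrite /chain_sum linear_sum; apply: eq_bigr => i _.
rewrite linear_sum; apply: eq_bigr => j _.
rewrite linear_sum; apply: eq_bigr => a _.
by rewrite linearZ /= rsubmx_iter_semi.
Qed.

Lemma row_mx_lsub (v : 'rV[C]_(r + p)) : rsubmx v = 0 -> row_mx (lsubmx v) 0 = v.
Proof. by move=> v0; rewrite -[RHS]hsubmxK v0. Qed.

(** Existence step. The ends of the lifted chains are independent in a kernel of dimension [r],
    which also yields the bound on [sumn m]. *)
Lemma consimilar_extend m c (N : 'M[C]_c) :
  N \in unitmx ->
  consimilar (drsubmx B) (dsum_mx (jordan0_sum C m) N) ->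
  (sumn m <= r)%N /\
  consimilar B (dsum_mx (jordan0_sum C ((r - sumn m)%N :: m)) N).
Proof.
move=> uN /chain_basis_consimilar[U [top [dim kill stab ind]]].
pose e i j : 'rV[C]_(r + p) := row_mx 0 (top i j).
(* Modulo the kernel, [V] is a lift of [U]; since [B] only sees the class modulo
   the kernel, [V] is moreover exactly stable. *)
pose V : 'M[C]_(c, r + p) := conj_mx (invmx N *m (row_mx 0 U *m B)).
have rV : rsubmx V = U.
  by rewrite rsubmx_conj -mulmx_rsub rsubmx_mul row_mxKr stab mulKmx // conj_mxK.
have stabV : V *m B = N *m conj_mx V.
  by rewrite conj_mxK mulKVmx // !mulmx_usub0 rV row_mxKr.
(* The kernel coordinates of the new ends; the other coordinates vanish because the original chains
   are killed one step earlier. *)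
pose g i j := lsubmx (iter i.+1 (semi B) (e i j)).
have rg i j : (j < nth 0 m i)%N -> rsubmx (iter i.+1 (semi B) (e i j)) = 0.
  by move=> ltj; rewrite rsubmx_iter_semi row_mxKr kill.
have indg : vec_indep m g.
  move=> y eq0 i j ltj; apply: (can_inj conjCK); rewrite conjC0.
  apply: (chain_socle_indep ind (y := fun i j => (y i j)^*)) => //.
  (* Pulling a relation among the new ends back through the semilinear map conjugates its
     coefficients. The resulting combination lies in the kernel, so in the quotient it is a relation
     among the old ends. *)
  suff: semi B (\sum_(i < size m) \sum_(j < nth 0%N m i)
      (y i j)^* *: iter i (semi B) (e i j)) = 0.
    move/semi_eq0; rewrite linear_sum => s0; rewrite -[RHS]s0.
    apply: eq_bigr => i' _; rewrite linear_sum; apply: eq_bigr => j' _.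
    by rewrite linearZ /= rsubmx_iter_semi row_mxKr.
  rewrite -[RHS](row_mx0 _ 1 r p) -[in RHS]eq0 semi_sum.
  rewrite [RHS](_ : _ = row_mx (lsubmx (\sum_(i < size m) \sum_(j < nth 0%N m i)
     y i j *: iter i.+1 (semi B) (e i j))) 0); last first.
    congr row_mx; rewrite linear_sum; apply: eq_bigr => i' _; rewrite linear_sum.
    by apply: eq_bigr => j' _; rewrite linearZ.
  rewrite row_mx_lsub.
    apply: eq_bigr => i' _; rewrite semi_sum; apply: eq_bigr => j' _.
    by rewrite semiZ conjCK.
  rewrite linear_sum big1 // => i' _; rewrite linear_sum big1 // => j' _.
  by rewrite linearZ /= rg // scaler0.
have [lemr [h indh]] := vec_indep_complement indg; split=> //.
apply/chain_basis_consimilar; exists V.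
exists (fun i j => if i is i'.+1 then e i' j else row_mx (h j) 0); split=> //.
- rewrite chain_dim_behead /= -dim; lia.
- case=> [|i] j ltj.
    by apply/semi_eq0; rewrite row_mxKr.
  by apply/semi_eq0; rewrite rg.
move=> x y; rewrite chain_sum_cons => eq0.
(* In the quotient, the chains of length 1 and the new ends vanish, which leaves a relation in the
   given basis. *)
have [x0 y0]: (forall i j a, (j < nth 0 m i)%N -> (a <= i)%N -> x i.+1 j a = 0) /\ y = 0.
  apply: ind; move/(congr1 (@rsubmx C 1 r p)): eq0.
  rewrite 3!linearD linear0 /= -mulmx_rsub rV rsubmx_chain_sum.
  rewrite [X in X + (_ + _) + _]linear_sum [X in X + (_ + _) + _]big1 ?add0r => [|j _]; last first.
    by rewrite linearZ /= row_mxKr scaler0.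
  rewrite [X in _ + X + _]linear_sum [X in _ + X + _]big1 ?addr0 => [|i _]; last first.
    by rewrite linear_sum big1 // => j _; rewrite linearZ /= rg // scaler0.
  move=> eq0; rewrite -[RHS]eq0; congr (_ + _); apply: eq_bigr => i _; apply: eq_bigr => j _.
  by apply: eq_bigr => a _; rewrite row_mxKr.
(* What remains of the relation lies in the kernel and only involves [h] and [g]. *)
split=> //; have [z0 w0] : (forall j, (j < r - sumn m)%N -> x 0%N j 0%N = 0) /\
    (forall i j, (j < nth 0 m i)%N -> x i.+1 j i.+1 = 0).
  apply: (indh (fun j => x 0%N j 0%N) (fun i j => x i.+1 j i.+1)).
  move/(congr1 (@lsubmx C 1 r p)): eq0; rewrite y0 mul0mx addr0.
  rewrite [X in _ + (X + _)]big1 => [|i _]; last first.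
    rewrite big1 // => j _; rewrite big1 // => a _.
    by rewrite x0 ?scale0r // -ltnS.
  rewrite add0r linearD linear0 /= => eq0; rewrite -[RHS]eq0; congr (_ + _).
    rewrite linear_sum; apply: eq_bigr => j _.
    by rewrite linearZ /= row_mxKl.
  rewrite linear_sum; apply: eq_bigr => i _; rewrite linear_sum.
  by apply: eq_bigr => j _; rewrite linearZ.
case=> [|i] j a /= ltj; first by rewrite leqn0 => /eqP->; apply: z0.
by rewrite leq_eqVlt => /predU1P[->|lea]; [apply: w0 | apply: x0].
Qed.

(** Uniqueness step. The chains truncated by one vector stay independent in the quotient, and the
    ends are independent in the kernel. Both counts are then bounded by the dimensions [p] and [r],
    and the total [r + p] forces equality. *)
Lemma consimilar_behead m c (N : 'M[C]_c) :
  N \in unitmx ->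
  consimilar B (dsum_mx (jordan0_sum C m) N) ->
  sumn m = r /\ consimilar (drsubmx B) (dsum_mx (jordan0_sum C (behead m)) N).
Proof.
move=> uN.
(* The empty list describes the same basis as [[:: 0]]. *)
wlog [d [m' ->]]: m / exists d m', m = d :: m'.
  case: m => [|d m] hm; last by apply: hm; exists d, m.
  move=> /chain_basis_consimilar[U [top [dim kill stab ind]]].
  apply: (hm [:: 0%N]); first by exists 0%N, [::].
  apply/chain_basis_consimilar; exists U, top; split=> //.
  - by rewrite -dim /chain_dim big_ord_recl !big_ord0.
  - by case=> [|[|i]].
  move=> x y eq0; have [|_ y0] := ind x y.
    by rewrite -[RHS]eq0 /chain_sum big_ord_recl !big_ord0 addr0.
  by split=> //; case=> [|[|i]].
move=> /chain_basis_consimilar[U [top [dim kill stab ind]]].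
pose t i j := rsubmx (top i.+1 j).
have indt : chain_indep (drsubmx B) m' (rsubmx U) t.
  move=> x y; rewrite -rsubmx_chain_sum mulmx_rsub -linearD => /semi_eq0 eq0.
  (* A combination that is zero in the quotient is killed by [semi B]. Applying [semi B] moves each
     vector one place down its chain and conjugates its coefficient, so tops and chains of length 1
     receive the coefficient 0. *)
  pose X i j a := if (i, a) is (i'.+1, a'.+1) then (x i' j a')^* else 0.
  have [|X0] := ind X (conj_mx (y *m N)).
    rewrite -[RHS]eq0 semiD; congr (_ + _); last first.
      by rewrite /semi -!mulmxA stab mulmxA !conj_mxM conj_mxK.
    rewrite /chain_sum big_ord_recl big1 ?add0r => [|j _]; last first.
      by rewrite big1 // => a _; rewrite scale0r.
    rewrite semi_sum; apply: eq_bigr => i _; rewrite semi_sum; apply: eq_bigr => j _.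
    rewrite semi_sum big_ord_recl scale0r add0r; apply: eq_bigr => a _.
    by rewrite semiZ.
  move/(congr1 (@conj_mx _ _ _)); rewrite conj_mxK conj_mx0 => /eqP.
  rewrite mulmx_free_eq0 ?row_free_unit // => /eqP y0; split=> // i j a ltj lea.
  by apply: (can_inj conjCK); rewrite conjC0; apply: (X0 i.+1 j a.+1).
have lemr : (sumn (d :: m') <= r)%N.
  apply: (proj1 (@vec_indep_complement _ (d :: m') (fun i j => lsubmx (iter i (semi B) (top i j))) _)).
  move=> y eq0; apply: (chain_socle_indep ind).
  rewrite -[LHS]row_mx_lsub.
    rewrite -[RHS](row_mx0 _ 1 r p) -[in RHS]eq0; congr row_mx.
    rewrite linear_sum; apply: eq_bigr => i _; rewrite linear_sum.
    by apply: eq_bigr => j _; rewrite linearZ.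
  rewrite linear_sum big1 // => i _; rewrite linear_sum big1 // => j _.
  by rewrite linearZ /= (proj1 (semi_eq0 _)) ?scaler0 //; apply: kill.
have ledim : (chain_dim m' + c <= p)%N.
  by move/chain_indepP: indt => /eqP <-; apply: rank_leq_col.
rewrite chain_dim_behead /= in dim lemr *.
have er : (d + sumn m' = r)%N by lia.
split=> //; apply/chain_basis_consimilar; exists (rsubmx U), t; split=> //.
- by lia.
- move=> i j ltj; rewrite /t -rsubmx_iter_semi.
  by apply/semi_eq0; apply: (kill i.+1).
by rewrite -rsubmx_mul stab -mulmx_rsub rsubmx_conj.
Qed.

End Step.

(** * The base case: nonsingular matrices *)

Lemma consimilar_dsum0 n (A : 'M[C]_n) :
  consimilar A (dsum_mx (jordan0_sum C [::]) A).
Proof.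
apply/chain_basis_consimilar; exists 1%:M, (fun _ _ => 0); split.
- by rewrite /chain_dim big_ord0.
- by move=> i j _; rewrite iter_semi0.
- by rewrite mul1mx /conj_mx map_mx1 mulmx1.
move=> x y; rewrite /chain_sum big_ord0 add0r mulmx1 => ->.
by split=> // i j a; rewrite nth_nil.
Qed.

(** An injective semilinear map has no nonzero chain ending in 0. The conclusion is [sumn m = 0]
    because [m] may still contain zeros. *)
Lemma consimilar_unit_dsum n (A : 'M[C]_n) m c (N : 'M[C]_c) :
  A \in unitmx -> consimilar A (dsum_mx (jordan0_sum C m) N) ->
  sumn m = 0%N /\ consimilar N A.
Proof.
move=> uA /chain_basis_consimilar[U [top [dim kill stab ind]]].
have m0 i : nth 0%N m i = 0%N.
  case E: (nth 0%N m i) => [|k] //; have lt0 : (0 < nth 0%N m i)%N by rewrite E.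
  have top0 : top i 0%N = 0.
    have := kill _ _ lt0.
    by elim: i.+1 => //= h IH /(semi_unit_inj uA).
  (* The indicator of the index [(i, 0)] is a relation, since that chain is zero; independence would
     then give [1 = 0]. *)
  have : ((i == i) && (0 == 0)%N)%:R = 0 :> C.
    apply: (chain_socle_indep ind (y := fun i' j' => ((i' == i) && (j' == 0%N))%:R)) => //.
    rewrite big1 // => i' _; rewrite big1 // => j' _.
    case: andP => [[/eqP ei /eqP->]|_]; last by rewrite scale0r.
    by rewrite {2}ei top0 iter_semi0 scaler0.
  by rewrite eqxx => /eqP; rewrite oner_eq0.
have dim0 : chain_dim m = 0%N.
  by rewrite /chain_dim big1 // => i _; rewrite m0 big_ord0.
split; first by move: dim0; rewrite chain_dim_behead; lia.
apply/consimilar_sym/consimilarP; split; first by rewrite -dim dim0.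
exists U => //; apply: inj_row_free => y yU0.
have [|_ ->] // := ind (fun _ _ _ => 0) y.
rewrite yU0 addr0 /chain_sum big1 // => i _; rewrite big1 // => j _.
by rewrite big1 // => a _; rewrite scale0r.
Qed.

(** * Induction on the run of the algorithm *)

Definition multiplicities (r : seq nat) : seq nat :=
  mkseq (fun i => nth 0 r i - nth 0 r i.+1)%N (size r).

Lemma multiplicities_cons r0 r :
  multiplicities (r0 :: r) = (r0 - nth 0 r 0)%N :: multiplicities r.
Proof. by rewrite /multiplicities /mkseq /= -[1%N]addn0 iotaDl -map_comp. Qed.

(** The sum telescopes; sortedness ensures that no subtraction on [nat] is truncated. *)
Lemma sumn_multiplicities r : sorted geq r -> sumn (multiplicities r) = nth 0%N r 0.
Proof.
elim: r => // r0 r IH; rewrite multiplicities_cons => sr.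
rewrite /= IH; last exact: path_sorted sr.
by apply: subnK; case: r sr {IH} => //= r1 r /andP[].
Qed.

Lemma reduction_output_unit n (A : 'M[C]_n) r q (At : 'M[C]_q) :
  reduction_output A r At -> At \in unitmx.
Proof. by elim. Qed.

Lemma reduction_step_shape r p (A S : 'M[C]_(r + p)) (A' : 'M[C]_(p, r + p))
    (B := S *m A *m invmx (conj_mx S)) :
  S \in unitmx -> S *m A = col_mx 0 A' -> row_free A' ->
  [/\ consimilar A B, usubmx B = 0 & row_free (dsubmx B)].
Proof.
move=> uS eSA fA'; split.
- by exists erefl, S; rewrite castmx_id.
- by rewrite /B eSA mul_col_mx mul0mx col_mxKu.
rewrite /B eSA mul_col_mx col_mxKd -row_leq_rank mxrankMfree ?row_leq_rank //.
by rewrite row_free_unit unitmx_inv unitmx_conj.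
Qed.

(** Both claims are proved together: the telescoped sum turns the bound on the number of lifted
    chains into the next inequality of the sorted list. *)
Lemma reduction_output_consimilar n (A : 'M[C]_n) r q (At : 'M[C]_q) :
  reduction_output A r At ->
  sorted geq r /\ consimilar A (dsum_mx (jordan0_sum C (multiplicities r)) At).
Proof.
elim=> {n A r q At} [n A uA | r0 p A S A' r q At _ uS eSA fA' red [sr simA]].
  by split=> //; apply: consimilar_dsum0.
have [simB B0 fB] := reduction_step_shape (unitarymx_unit uS) eSA fA'.
have [] := consimilar_extend B0 fB (reduction_output_unit red) simA.
rewrite sumn_multiplicities // -multiplicities_cons => ler0 simJ.
split; last exact: consimilar_trans simB simJ.
by case: r sr ler0 {red simA simJ} => //= r1 r -> ->.
Qed.

(** The total number of chains is added to the conclusion so that the induction can recover the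
    first multiplicity. *)
Lemma reduction_output_unique n (A : 'M[C]_n) r q (At : 'M[C]_q) :
  reduction_output A r At -> forall m c (N : 'M[C]_c),
  N \in unitmx -> consimilar A (dsum_mx (jordan0_sum C m) N) ->
  [/\ sumn m = nth 0%N r 0, forall i, nth 0%N m i = (nth 0 r i - nth 0 r i.+1)%N
    & consimilar N At].
Proof.
elim=> {n A r q At} [n A uA | r0 p A S A' r q At _ uS eSA fA' red IH] m c N uN simA.
  have [m0 simN] := consimilar_unit_dsum uA simA; split=> // i.
  rewrite !nth_nil; elim: m i m0 {simA} => [|d m IH] [|i] //= /eqP.
    by rewrite addn_eq0 => /andP[/eqP].
  by rewrite addn_eq0 => /andP[_ /eqP/IH].
have [simB B0 fB] := reduction_step_shape (unitarymx_unit uS) eSA fA'.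
have [sm /(IH _ _ _ uN)[sm' mE simN]] :=
  consimilar_behead B0 fB uN (consimilar_trans (consimilar_sym simB) simA).
split=> // -[|i] /=; last by rewrite -mE nth_behead.
(* The chains of length 1 are those lost in the quotient: [sumn m - sumn (behead m)]. *)
by rewrite -sm' -sm; case: (m) => //= d m'; rewrite addnK.
Qed.

End Consimilarity.

Theorem theorem2 (R : realType) (n : nat) (A : 'M[R[i]]_n)
    (r : seq nat) (q : nat) (At : 'M[R[i]]_q)
    (hred : reduction_output A r At) :
  [/\ sorted geq r,
      consimilar A
        (dsum_mx (jordan0_sum R[i]
                    (mkseq (fun i => nth 0 r i - nth 0 r i.+1)%N (size r)))
                 At)
    & forall (m : seq nat) (c : nat) (C : 'M[R[i]]_c),
        C \in unitmx ->
        consimilar A (dsum_mx (jordan0_sum R[i] m) C) ->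
        (forall i : nat, nth 0%N m i = (nth 0 r i - nth 0 r i.+1)%N) /\
        consimilar C At].
Proof.
have [sr simA] := reduction_output_consimilar hred; split=> // m c C uC simC.
by have [] := reduction_output_unique hred uC simC.
Qed.
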